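(* A topological group $G$ is isomorphic (as a topological group) to $\mathbb{R}$ if and only if $G$ is one-parametric, metrizable, and not monothetic.
   Context: All topological groups are assumed to be Hausdorff. $\mathbb{R}$ denotes the additive group of reals with the Euclidean topology. Two topological groups are isomorphic if there is a group isomorphism between them that is also a homeomorphism. A topological group $G$ is one-parametric if there exists a surjective continuous group homomorphism $\phi:\mathbb{R}\to G$. A topological group $G$ is monothetic if there exists $g\in G$ such that the cyclic subgroup $\{ng:n\in\mathbb{Z}\}$ is dense in $G$. *)

(* Defs.v *)
From HB Require Import structures.
From mathcomp Require Import all_boot all_order all_algebra.
From mathcomp Require Import all_classical all_reals all_analysis.

Set Implicit Arguments.
Unset Strict Implicit.
Unset Printing Implicit Defensive.

Import GRing.Theory Num.Theory.
Import numFieldNormedType.Exports.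

Local Open Scope classical_set_scope.
Local Open Scope group_scope.

(* MathComp-Analysis only has abelian (additively written) topological groups
   (topologicalZmodType); here commutativity is not required. The Hausdorff
   condition is not part of the structure. *)
HB.mixin Record isTopologicalGroup G & Group G & Topological G := {
  mulg_continuous : continuous (fun x : G * G => x.1 * x.2) ;
  invg_continuous : continuous (fun x : G => x^-1)
}.

#[short(type="topologicalGroupType")]
HB.structure Definition TopologicalGroup :=
  {G of Group G & Topological G & isTopologicalGroup G}.

(* Algebra.to_multiplicative M is M itself, with the group law written
   multiplicatively: x * y is x + y, 1 is 0 and x^-1 is - x. *)
HB.instance Definition _ (M : topologicalZmodType) :=
  Topological.copy (Algebra.to_multiplicative M) M.
HB.instance Definition _ (M : topologicalZmodType) :=
  isTopologicalGroup.Build (Algebra.to_multiplicative M)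
    (@add_continuous M) (@opp_continuous M).

Definition real_group (R : realType) : topologicalGroupType :=
  Algebra.to_multiplicative R.

Definition topgroup_isomorphic (G H : topologicalGroupType) : Prop :=
  exists f : G -> H, exists g : H -> G,
    [/\ {morph f : x y / x * y}, cancel f g, cancel g f,
        continuous f & continuous g].

Definition one_parametric (R : realType) (G : topologicalGroupType) : Prop :=
  exists phi : real_group R -> G,
    [/\ {morph phi : x y / x * y}, continuous phi & range phi = [set: G]].

Definition expgz (G : groupType) (g : G) (n : int) : G :=
  match n with Posz m => g ^+ m | Negz m => g ^- m.+1 end.

Definition monothetic (G : topologicalGroupType) : Prop :=
  exists g : G, dense (range (expgz g)).

Definition metrizable (R : realType) (T : topologicalType) : Prop :=
  exists d : T -> T -> R,
    [/\ forall x y, d x y = 0%R <-> x = y,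
        forall x y, d x y = d y x,
        forall x y z, (d x z <= d x y + d y z)%R &
        forall x : T,
          nbhs x = filter_from [set e : R | (0 < e)%R]
                               (fun e => [set y | (d x y < e)%R])].

(* Main.v *)
Require Import Defs.
From mathcomp Require Import all_boot all_order all_algebra.
From mathcomp Require Import all_classical all_reals all_analysis.
From mathcomp Require Import ring lra.

(** If [G] is isomorphic to the real line, it is metrizable because the metric
    of the line can be pulled back, and it is not monothetic because the
    integer multiples of a nonzero real [g] miss the interval from [0] to [|g|],
    while [0] generates the trivial group ([real_not_monothetic]).

    Conversely, let [phi] be a continuous homomorphism from the line onto [G].
    There are two possibilities.

    - The path [phi t] comes back to every neighbourhood of the identity at
      arbitrarily large times [t]. Then [G] is monothetic
      ([recurrent_monothetic]). Indeed the preimage [D] of a nonempty open set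
      of [G] is then an open subset of the line that is unbounded above, and the
      reals having an integer multiple in such a [D] form a dense open set
      ([dense_dilates], [open_dilates]). Since [G] is metrizable and is the
      image of a separable space, countably many open sets suffice to test
      density in [G] ([metrizable_pi_base]). By Baire's theorem some real [s]
      has, for each of these test sets, a multiple that [phi] sends into it,
      so the powers of [phi s] are dense.

    - Some neighbourhood of the identity is avoided from some time on. Then
      [phi] is injective, since a nonzero period would bring the path back to
      the identity again and again, and it is open by compactness of bounded
      closed sets of reals, so it is an isomorphism ([escaping_isomorphic]).

    A nontrivial kernel falls under the first possibility, so that circles and
    dense windings of tori are treated by the same argument. *)

Set Implicit Arguments.
Unset Strict Implicit.
Unset Printing Implicit Defensive.

Import Order.TTheory GRing.Theory Num.Theory.
Import numFieldNormedType.Exports.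

Local Open Scope classical_set_scope.
Local Open Scope ring_scope.

(** The intervals from [n * a] to [n * b] have growing length [n * (b - a)], so
    from some point on they overlap and cover a whole half-line, which contains
    a point of [D]. *)
Lemma unbounded_meets_multiples (R : realType) (D : set R) (a b : R) :
  (forall N, exists2 t, N < t & D t) -> 0 < a -> a < b ->
  exists s, exists n : nat, [/\ a < s, s < b & D (s *+ n)].
Proof.
move=> Dub a0 ab; have b0 : 0 < b by exact: lt_trans ab.
(* Beyond this bound, the interval from [t / b] to [t / a] is longer than 1,
   hence contains an integer [n], and [t / n] lies between [a] and [b]. *)
have [t tN Dt] := Dub (a * b / (b - a)).
have ba0 : 0 < b - a by rewrite subr_gt0.
have t0 : 0 < t by apply: lt_trans tN; rewrite divr_gt0 ?mulr_gt0.
have gap : t / b + 1 < t / a.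
  rewrite -ltrBrDl; have -> : t / a - t / b = t * ((b - a) / (a * b)).
    by field; rewrite (gt_eqF a0) (gt_eqF b0).
  by rewrite -ltr_pdivrMr ?divr_gt0 ?mulr_gt0// div1r invf_div.
have /andP[lo hi] := truncn_itv (ltW (divr_gt0 t0 b0)).
set n := (Num.truncn (t / b)).+1 in hi.
have n0 : 0 < n%:R :> R by rewrite ltr0n.
exists (t / n%:R), n; split.
- rewrite ltr_pdivlMr// mulrC -ltr_pdivlMr//.
  by apply: le_lt_trans gap; rewrite /n -natr1 lerD2r.
- by rewrite ltr_pdivrMr// mulrC -ltr_pdivrMr.
- by rewrite -[_ *+ n]mulr_natr divfK// gt_eqF.
Qed.

Lemma dense_dilates (R : realType) (D : set R) :
  (forall N, exists2 t, N < t & D t) ->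
  dense [set s | exists n : int, D (s *~ n)].
Proof.
move=> Dub O [x Ox] oO.
have /nbhs_ballP[e /= e0 xeO] : nbhs x O by exact: open_nbhs_nbhs.
(* The ball may contain 0 or lie on the negative side: the witness is sought
   in the part of the ball that points away from 0, up to a change of sign. *)
have [x0|x0] := leP 0 x.
- have [||s [n [s1 s2 Dsn]]] :=
    @unbounded_meets_multiples R D (x + e / 2) (x + e) Dub.
  + lra.
  + lra.
  exists s; split; last by exists n.
  by apply: xeO; rewrite /ball/= ltr_norml; apply/andP; split; lra.
- have [||s [n [s1 s2 Dsn]]] :=
    @unbounded_meets_multiples R D (- x + e / 2) (- x + e) Dub.
  + lra.
  + lra.
  exists (- s); split; last by exists (- n%:Z); rewrite mulrNz mulNrz opprK.
  by apply: xeO; rewrite /ball/= ltr_norml; apply/andP; split; lra.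
Qed.

Lemma open_dilates (R : realType) (D : set R) : open D ->
  open [set s | exists n : int, D (s *~ n)].
Proof.
move=> oD.
have -> : [set s | exists n : int, D (s *~ n)] =
    \bigcup_(n in [set: int]) ((fun s => s *~ n) @^-1` D).
  by apply/seteqP; split => [s [n Dsn]|s [n _ Dsn]]; exists n.
apply: bigcup_open => n _; apply: open_comp => // x _.
under [X in continuous_at _ X]eq_fun do rewrite -mulrzr.
exact: mulrr_continuous.
Qed.

Lemma morph_mulg1 (G H : groupType) (f : G -> H) :
  {morph f : x y / (x * y)%g} -> f 1%g = 1%g.
Proof. by move=> fM; apply: (mulgI (f 1%g)); rewrite -fM !mulg1. Qed.

Lemma morph_invg (G H : groupType) (f : G -> H) :
  {morph f : x y / (x * y)%g} -> {morph f : x / (x^-1)%g}.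
Proof.
by move=> fM x; apply: (mulgI (f x)); rewrite -fM !mulgV morph_mulg1.
Qed.

Lemma morph_expgz (G H : groupType) (f : G -> H) :
  {morph f : x y / (x * y)%g} -> forall n, {morph f : x / expgz x n}.
Proof.
move=> fM.
have fX n x : f (x ^+ n)%g = (f x ^+ n)%g.
  by elim: n => [|n IHn]; rewrite ?expg0 ?morph_mulg1// !expgS fM IHn.
by case=> n x; rewrite /expgz ?morph_invg// fX.
Qed.

Lemma expgz_real (R : realType) (x : R) (n : int) :
  expgz (x : real_group R) n = x *~ n.
Proof. by case: n. Qed.

Lemma cvg_mulg (G : topologicalGroupType) (T : Type) (F : set_system T)
    {FF : Filter F} (f g : T -> G) (a b : G) :
  f @ F --> a -> g @ F --> b -> (f x * g x)%g @[x --> F] --> (a * b)%g.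
Proof. by move=> fa gb; exact: cvg_comp2 fa gb (mulg_continuous (a, b)). Qed.

Lemma monothetic_isomorphic (G H : topologicalGroupType) :
  topgroup_isomorphic G H -> monothetic G -> monothetic H.
Proof.
move=> [f [g [fM fK gK fC gC]]] [x xd].
exists (f x) => O [y Oy] oO.
have [z [Ofz [n _ zE]]] : f @^-1` O `&` range (expgz x) !=set0.
  apply: xd; first by exists (g y); rewrite /preimage/= gK.
  by apply: open_comp => // ? _; exact: fC.
by exists (f z); split => //; exists n => //; rewrite -zE morph_expgz.
Qed.

Lemma real_not_monothetic (R : realType) : ~ monothetic (real_group R).
Proof.
move=> [g gd].
have [c c0 gc] : exists2 c : R, 0 < c &
    forall n : int, 0 < (g : R) *~ n -> c <= (g : R) *~ n.
  have [->|g0] := eqVneq (g : R) 0.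
    by exists 1 => // n; rewrite mul0rz ltxx.
  exists `|g : R|; first by rewrite normr_gt0.
  move=> n gn; rewrite -(gtr0_norm gn) -mulrzr normrM -intr_norm.
  rewrite ler_peMr// -(mulr1z 1) ler_int -gtz0_ge1 normr_gt0.
  by apply: contraTneq gn => ->; rewrite mulr0z ltxx.
have [x [x0c [n _ xE]]] :
    (`]0, c[%classic : set (real_group R)) `&` range (expgz g) !=set0.
  apply: gd; last exact: (@interval_open R (BRight 0) (BLeft c) isT isT).
  by exists (c / 2); rewrite /= in_itv/=; apply/andP; split; lra.
move: x0c; rewrite -xE /= in_itv/= expgz_real => /andP[/gc + ].
by move=> /le_lt_trans /[apply]; rewrite ltxx.
Qed.

Lemma metrizable_isomorphic (R : realType) (G : topologicalGroupType) :
  topgroup_isomorphic G (real_group R) -> metrizable R G.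
Proof.
move=> [f [g [_ fK gK fC gC]]].
exists (fun x y => `|(f x : R) - (f y : R)|); split.
- move=> x y; split=> [/eqP|->]; last by rewrite subrr normr0.
  by rewrite normr_eq0 subr_eq0 => /eqP /(can_inj fK).
- by move=> x y; rewrite distrC.
- by move=> x y z; exact: ler_distD.
move=> x; apply/seteqP; split => [U /= xU|U [e /= e0 eU]].
  have : nbhs (f x) (g @^-1` U) by apply: gC; rewrite fK.
  move=> /(@nbhs_ballP R R)[e /= e0 eU]; exists e => //= y xy.
  by have /= := eU (f y) xy; rewrite /preimage/= fK.
apply: (filterS eU); have -> : [set y | `|(f x : R) - (f y : R)| < e] =
    f @^-1` ball (f x : R) e by [].
apply: (fC x).
exact: (@nbhsx_ballx R R (f x) e).
Qed.

(** A countable family such as [B], known as a pi-base, is what the Baire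
    argument needs: a set meeting every [B n] is dense. Balls of radius
    [1 / m.+1] around the images of the rationals do, as these are dense. *)
Lemma metrizable_pi_base (R : realType) (T : topologicalType) (f : R -> T) :
  continuous f -> range f = setT -> metrizable R T ->
  exists B : nat -> set T,
    (forall n, open (B n) /\ B n !=set0) /\
    (forall O : set T, O !=set0 -> open O -> exists n, B n `<=` O).
Proof.
move=> fC fsurj [d [d0 dC dD dnbhs]].
have dball x e : 0 < e -> nbhs x [set y | d x y < e].
  by move=> e0; rewrite dnbhs; exists e.
pose C (p : rat * nat) := ([set y | d (f (ratr p.1)) y < p.2.+1%:R^-1])°.
have CC p : C p (f (ratr p.1)).
  by apply: dball; rewrite invr_gt0 ltr0n.
(* Natural numbers that do not code a pair of a rational and a radius get the full
   set, which is open and nonempty too. *)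
exists (fun n => if unpickle n is Some p then C p else setT); split.
  move=> n; case: unpickle => [p|]; last first.
    by split; [exact: openT|exists (f 0)].
  by split; [exact: open_interior|exists (f (ratr p.1))].
move=> O [x Ox] oO.
have : nbhs x O by exact: open_nbhs_nbhs.
rewrite dnbhs => -[e /= e0 eO].
have [m me] : exists m : nat, m.+1%:R^-1 < e / 2.
  exists (Num.truncn (e / 2)^-1); rewrite invf_plt ?posrE ?divr_gt0//.
  by rewrite truncnS_gt.
have [z [xq [q _ zE]]] : f @^-1` ([set y | d x y < m.+1%:R^-1]°) `&`
    range (@ratr R) !=set0.
  apply: dense_rat.
    have [t _ tx] : range f x by rewrite fsurj.
    by exists t; rewrite /preimage/= tx; apply: dball; rewrite invr_gt0.
  by apply: open_comp; [move=> ? _; exact: fC|exact: open_interior].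
have {}xq := interior_subset xq.
rewrite -{}zE /= in xq.
exists (pickle (q, m)); rewrite pickleK => y /interior_subset/= qy.
apply: eO => /=; apply: le_lt_trans (dD _ (f (ratr q)) _) _.
move: me xq qy; set u := m.+1%:R^-1; set v := d x _; set w := d _ y; lra.
Qed.

(** A generic real [s] works: for each test set [B n], a dense open set of reals
    [s] satisfy [phi (s *~ k) \in B n] for some [k], and the intersection of
    these countably many conditions is nonempty by Baire's theorem. *)
Lemma recurrent_monothetic (R : realType) (G : topologicalGroupType)
    (phi : real_group R -> G) :
  {morph phi : x y / (x * y)%g} -> continuous phi -> range phi = setT ->
  metrizable R G ->
  (forall U, nbhs 1%g U -> forall N : R, exists2 t : R, N < t & U (phi t)) ->
  monothetic G.
Proof.
move=> phiM phiC phis Gm rec.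
have [B [BP BO]] := @metrizable_pi_base R G phi phiC phis Gm.
(* Close returns to the identity, translated by [phi q], are close returns to
   the point [phi q] of [B n]. *)
have ub n N : exists2 t : R, N < t & (phi @^-1` B n) t.
  have [oB [y By]] := BP n; have [q _ qy] : range phi y by rewrite phis.
  have [|t Nt Bt] := rec [set g | B n (phi q * g)%g] _ (N - (q : R)).
    have qg : (phi q * g)%g @[g --> (1%g : G)] --> (phi q * 1)%g.
      by apply: cvg_mulg; [exact: cvg_cst|exact: cvg_id].
    by apply: qg; rewrite mulg1 qy; exact: open_nbhs_nbhs.
  exists ((q : R) + t); first by rewrite -ltrBlDl.
  by have /= := Bt; rewrite -phiM.
have [s [_ sB]] : setT `&`
    \bigcap_n [set s : R | exists k : int, (phi @^-1` B n) (s *~ k)] !=set0.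
  apply: (@Baire R R^o); [|by exists 0|exact: openT].
  move=> n; split; last exact: dense_dilates (ub n).
  apply: open_dilates; apply: (@open_comp (real_group R)) (proj1 (BP n)) => //.
exists (phi s) => O O0 oO.
have [n BnO] := BO O O0 oO.
have [k Bk] := sB n I.
exists (phi (s *~ k)); split; first exact: BnO.
by exists k => //; rewrite -(morph_expgz phiM k (s : real_group R)) expgz_real.
Qed.

(** By homogeneity it is enough that the inverse of [phi] be continuous at the
    identity. Close to the identity only bounded times occur, and the bounded
    times [t] with [e <= |t|] form a compact set, whose image is closed and
    misses the identity. *)
Lemma escaping_isomorphic (R : realType) (G : topologicalGroupType)
    (phi : real_group R -> G) (U : set G) (N : R) :
  hausdorff_space G ->
  {morph phi : x y / (x * y)%g} -> continuous phi -> range phi = setT ->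
  nbhs 1%g U -> (forall t : R, U (phi t) -> t <= N) ->
  topgroup_isomorphic G (real_group R).
Proof.
move=> hG phiM phiC phis U1 UN.
have phiV (t : R) : phi (- t) = (phi t)^-1%g by exact: (morph_invg phiM).
have ker (t : R) : phi t = 1%g -> t = 0.
  move=> t1; apply/eqP/negPn/negP => t0.
  have tn1 (n : nat) : phi (`|t| *+ n) = 1%g.
    have a1 : phi `|t| = 1%g.
      by case: (ger0P t) => _; rewrite ?phiV t1 ?invg1.
    have := morph_expgz phiM n (`|t| : real_group R).
    by rewrite expgz_real a1 => ->; rewrite /= expg1n.
  have : `|t| *+ (Num.truncn (N / `|t|)).+1 <= N.
    by apply: UN; rewrite tn1; exact: nbhs_singleton.
  rewrite -mulr_natl -ler_pdivlMr ?normr_gt0//.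
  by rewrite leNgt truncnS_gt.
have /choice[psi psiK] y : exists x, phi x = y.
  by have [x _ xy] : range phi y by [rewrite phis]; exists x.
have phiK : cancel phi psi.
  move=> t; apply/eqP; rewrite -subr_eq0; apply/eqP/ker.
  have -> : phi ((psi (phi t) : R) - (t : R)) =
      (phi (psi (phi t)) * (phi t)^-1)%g.
    by rewrite -phiV -phiM.
  by rewrite psiK mulgV.
have psiM : {morph psi : x y / (x * y)%g}.
  by move=> x y; rewrite -[RHS]phiK phiM !psiK.
have small e : 0 < e -> nbhs 1%g [set y | `|psi y : R| < e].
  move=> e0.
  pose K : set R := `[- N, N]%classic `&` [set t | e <= `|t|].
  have cK : compact K.
    apply: compact_closedI; first exact: segment_compact.
    apply: (@preimage_closed R R Num.norm [set x | e <= x]) (@closed_ge _ e).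
    by move=> ? _; exact: norm_continuous.
  have : closed (phi @` K).
    apply: compact_closed => //.
    apply: (@continuous_compact (real_group R)) => //.
    exact: continuous_subspaceT.
  move=> /closed_openC cKo.
  have K1 : nbhs 1%g (~` (phi @` K)).
    apply: open_nbhs_nbhs; split => // -[t [_ /= et] /ker t0].
    by move: et; rewrite t0 normr0 leNgt e0.
  (* [UN] bounds times from above only; the lower bound comes from inverses. *)
  have UV1 : nbhs 1%g [set y | U y^-1%g].
    by apply: (@invg_continuous G 1%g); rewrite invg1.
  near=> y => /=; rewrite ltNge; apply/negP => ey.
  have : (~` (phi @` K)) y by near: y.
  apply; exists (psi y); last exact: psiK.
  split => //; rewrite /= in_itv/= lerNl; apply/andP; split; apply: UN.
  - by rewrite phiV psiK; near: y.
  - by rewrite psiK; near: y.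
exists psi, phi; split => // y A /(@nbhs_ballP R R)[e /= e0 eA].
have yV : (y * z^-1)%g @[z --> y] --> (y * y^-1)%g.
  by apply: cvg_mulg; [exact: cvg_cst|exact: invg_continuous].
have yVe : nbhs y [set z | `|psi (y * z^-1)%g : R| < e].
  by rewrite mulgV in yV; exact: (yV [set g | `|psi g : R| < e] (small e e0)).
suff : [set z | `|psi (y * z^-1)%g : R| < e] `<=` psi @^-1` A.
  by move/filterS; apply.
move=> z /= yz.
apply: eA; rewrite /ball/=.
by move: yz; rewrite psiM (morph_invg psiM).
Unshelve. all: by end_near.
Qed.

Theorem theorem4p2 (R : realType) (G : topologicalGroupType) :
  hausdorff_space G ->
  (topgroup_isomorphic G (real_group R) <->
   [/\ one_parametric R G, metrizable R G & ~ monothetic G]).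
Proof.
move=> hG; split=> [iso|[[phi [phiM phiC phis]] Gm Gnm]].
  split.
  - have [f [g [fM fK gK fC gC]]] := iso.
    exists g; split => //; last by apply/seteqP; split => // x _; exists (f x).
    by move=> x y; apply: (can_inj fK); rewrite fM !gK.
  - exact: metrizable_isomorphic.
  - by move=> /(monothetic_isomorphic iso); exact: real_not_monothetic.
apply: contrapT => niso; apply/Gnm/(recurrent_monothetic phiM phiC phis Gm).
move=> U U1 N; apply: contrapT => nrec; apply: niso.
apply: (escaping_isomorphic hG phiM phiC phis U1 (N := N)) => t Ut.
by rewrite leNgt; apply/negP => Nt; apply: nrec; exists t.
Qed.
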